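(* Let $Q$ be a multiset of cardinality $n$ over $\mathcal{N}$. Then the map $\varrho\colon \mathcal{A}(S_n)\to \mathrm{End}(\mathcal{B}_Q)$ determined by $\varrho(pg)=\varrho_1(p)\cdot\varrho_2(g)$ for all $p\in R_n$, $g\in S_n$, and extended by additivity, is a representation of $\mathcal{A}(S_n)$ on $\mathcal{B}_Q$, i.e. an algebra homomorphism.
   Context: Free algebra and weight subspaces: $\mathcal{N}$ is a fixed finite set of nonnegative integers, and $q_{ij}$ ($i,j\in\mathcal{N}$) are given complex numbers. $\mathcal{B}$ is the free unital associative $\mathbb{C}$-algebra on generators $e_i$, $i\in\mathcal{N}$. For a multiset $Q=\{l_1\le\dots\le l_n\}$ over $\mathcal{N}$ of cardinality $n$, $\widehat{Q}$ denotes the set of all distinct permutations $\underline{j}=j_1\dots j_n$ of $Q$, and $\mathcal{B}_Q$ is the complex vector space with basis the monomials $e_{j_1\dots j_n}:=e_{j_1}\cdots e_{j_n}$, $j_1\dots j_n\in\widehat{Q}$. Twisted group algebra: $R_n=\mathbb{C}[X_{a\,b}\mid 1\le a,b\le n]$ is the polynomial ring in $n^2$ commuting variables. $\mathcal{A}(S_n)=R_n\rtimes\mathbb{C}[S_n]$ consists of the formal linear combinations $\sum_{g\in S_n}p_g\,g$ with $p_g\in R_n$, with multiplication $(p_1g_1)\cdot(p_2g_2)=(p_1\cdot(g_1.p_2))\,g_1g_2$, where $g.p$ is the polynomial obtained from $p$ by replacing each $X_{a\,b}$ by $X_{g(a)\,g(b)}$, and $g_1g_2$ is the composition ($g_2$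 applied first). The maps: for $1\le a,b\le n$, $Q_{a\,b}$ is the diagonal operator on $\mathcal{B}_Q$ given by $Q_{a\,b}\,e_{j_1\dots j_n}=q_{j_aj_b}\,e_{j_1\dots j_n}$; these operators commute. $\varrho_1\colon R_n\to\mathrm{End}(\mathcal{B}_Q)$ is the $\mathbb{C}$-algebra homomorphism with $\varrho_1(X_{a\,b})=Q_{a\,b}$. For $g\in S_n$, $\varrho_2(g)\,e_{j_1\dots j_n}=e_{j_{g^{-1}(1)}\dots j_{g^{-1}(n)}}$, and $\varrho_2$ is extended linearly to $\mathbb{C}[S_n]$. *)

(* Defs.v *)
From HB Require Import structures.
From mathcomp Require Import all_boot all_order all_algebra all_fingroup.
From mathcomp Require Import finmap multiset mpoly monalg.

Set Implicit Arguments.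
Unset Strict Implicit.
Unset Printing Implicit Defensive.

Import GRing.Theory.
Local Open Scope mset_scope.
Local Open Scope ring_scope.

Notation free_algebra K I := {malg K[{fmonom I}]}.

Section FreeAlgebra.

Variables (K : fieldType) (I : finType).

Definition gen (i : I) : free_algebra K I := << fmu i >>.

Definition monomial (w : seq I) : free_algebra K I := \prod_(i <- w) gen i.

Lemma monomialE w : monomial w = << FMonom w >>.
Proof.
rewrite /monomial; elim: w => [|i w IHw].
  rewrite big_nil; congr (<< _ >>).
  by apply/val_inj; rewrite /= fm1.
rewrite big_cons IHw /gen malgM_def fgmulUU mulr1; congr (<< _ >>).
by apply/val_inj; rewrite /= fmM fmU.
Qed.

End FreeAlgebra.

Section WeightSpace.

Variables (K : fieldType) (I : finType) (Q : {mset I}).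

(* The distinct permutations of the multiset Q: words with the same letters,
   counted with multiplicity. *)
Definition arrangement := {j : (size Q).-tuple I | perm_eq j Q}.

(* The span of the monomials e_j, j an arrangement of Q (weight_space_sum and
   weight_coeff_basis show that these form a basis): only words that are
   rearrangements of Q occur in v. *)
Definition weight_pred : {pred free_algebra K I} :=
  fun v => all (fun m : {fmonom I} => perm_eq m Q) (msupp v).

Lemma weight_predP (v : free_algebra K I) :
  reflect (forall m : {fmonom I}, ~~ perm_eq m Q -> mcoeff m v = 0)
          (v \in weight_pred).
Proof.
apply: (iffP allP) => [h m|h m mv].
  by case: msuppP => // /h ->.
by apply: contraTT mv => /h /eqP; rewrite mcoeff_eq0.
Qed.

Lemma weight_submod_closed : submod_closed weight_pred.
Proof.
split=> [|a u v /weight_predP hu /weight_predP hv].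
  by apply/weight_predP => m _; rewrite mcoeff0.
by apply/weight_predP => m hm; rewrite mcoeffD mcoeffZ hu // hv // mulr0 addr0.
Qed.

HB.instance Definition _ :=
  GRing.isSubmodClosed.Build K (free_algebra K I) weight_pred
    weight_submod_closed.

Record weight_space : predArgType :=
  WeightSpace { weight_val : free_algebra K I; _ : weight_val \in weight_pred }.

HB.instance Definition _ := [isSub for weight_val].
HB.instance Definition _ := [Choice of weight_space by <:].
HB.instance Definition _ := [SubChoice_isSubLmodule of weight_space by <:].

Lemma monomial_weight (j : arrangement) :
  monomial K (val j) \in weight_pred.
Proof.
apply/weight_predP => m; rewrite monomialE mcoeffU.
by case: eqP => // <-; rewrite (valP j).
Qed.

Definition basis_monomial (j : arrangement) : weight_space :=
  WeightSpace (monomial_weight j).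

Definition weight_coeff (j : arrangement) (v : weight_space) : K :=
  mcoeff (FMonom (val j)) (val v).

Lemma weight_coeff_is_linear j : linear_for *%R (weight_coeff j).
Proof.
by move=> a u v; rewrite /weight_coeff GRing.valD GRing.valZ mcoeffD mcoeffZ.
Qed.

HB.instance Definition _ j :=
  GRing.isLinear.Build K weight_space K *%R (weight_coeff j)
    (weight_coeff_is_linear j).

Lemma weight_coeff_basis (i j : arrangement) :
  weight_coeff i (basis_monomial j) = (i == j)%:R.
Proof.
by rewrite /weight_coeff /= monomialE mcoeffU1 eq_sym.
Qed.

Lemma weight_spaceP (u v : weight_space) :
  (forall j, weight_coeff j u = weight_coeff j v) -> u = v.
Proof.
move=> uv; apply/val_inj/malgP => m.
have [mQ|mQ] := boolP (perm_eq m Q); last first.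
  by rewrite (weight_predP _ (valP u)) // (weight_predP _ (valP v)).
have sm : size m == size Q by rewrite (perm_size mQ).
have := uv (exist _ (Tuple sm) mQ); rewrite /weight_coeff /=.
by have -> : FMonom m = m by apply/val_inj.
Qed.

Lemma weight_space_sum (v : weight_space) :
  v = \sum_j weight_coeff j v *: basis_monomial j.
Proof.
apply: weight_spaceP => i; rewrite linear_sum (bigD1 i) //= linearZ /=.
rewrite weight_coeff_basis eqxx mulr1 big1 ?addr0 // => j ji.
by rewrite linearZ /= weight_coeff_basis eq_sym (negbTE ji) mulr0.
Qed.

Fact weight_space_vect_iso : Vector.axiom #|{: arrangement}| weight_space.
Proof.
exists (fun v => \row_k weight_coeff (enum_val k) v).
  by move=> a u v; apply/rowP => k; rewrite !mxE linearP.
exists (fun r : 'rV_#|{: arrangement}| =>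
          \sum_j r 0 (enum_rank j) *: basis_monomial j) => [v|r].
  rewrite [RHS]weight_space_sum; apply: eq_bigr => j _.
  by rewrite mxE enum_rankK.
apply/rowP => k; rewrite mxE linear_sum (bigD1 (enum_val k)) //= linearZ /=.
rewrite weight_coeff_basis eqxx mulr1 enum_valK big1 ?addr0 // => j jk.
by rewrite linearZ /= weight_coeff_basis eq_sym (negbTE jk) mulr0.
Qed.

HB.instance Definition _ :=
  Lmodule_hasFinDim.Build K weight_space weight_space_vect_iso.

Definition linear_extension (f : arrangement -> weight_space) (v : weight_space)
    : weight_space :=
  \sum_j weight_coeff j v *: f j.

Lemma linear_extension_is_linear f : linear (linear_extension f).
Proof.
move=> a u v; rewrite /linear_extension scaler_sumr -big_split /=.
by apply: eq_bigr => j _; rewrite linearP scalerDl scalerA.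
Qed.

HB.instance Definition _ f :=
  GRing.isLinear.Build K weight_space weight_space _ (linear_extension f)
    (linear_extension_is_linear f).

Lemma linear_extension_basis f j : linear_extension f (basis_monomial j) = f j.
Proof.
rewrite /linear_extension (bigD1 j) //= weight_coeff_basis eqxx scale1r.
rewrite big1 ?addr0 // => i ij.
by rewrite weight_coeff_basis (negbTE ij) scale0r.
Qed.

(* End(B_Q) with composition as product. The library's algebra structures on
   'End(V) (lfun_algType, FalgLfun) use the reversed product, hence the new
   alias. *)
Definition weight_end := 'End(weight_space).
Identity Coercion hom_of_weight_end : weight_end >-> hom.

Lemma weight_end1_neq0 : \1%VF != 0 :> weight_end.
Proof.
have j : arrangement by exists (in_tuple Q); apply: perm_refl.
apply/eqP => /lfunP /(_ (basis_monomial j)); rewrite !lfunE /=.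
move=> /(congr1 (weight_coeff j)); rewrite weight_coeff_basis eqxx linear0.
by apply/eqP/oner_neq0.
Qed.

HB.instance Definition _ := Vector.on weight_end.
HB.instance Definition _ := GRing.Zmodule_isNzRing.Build weight_end
  (fun f g h => comp_lfunA f g h) (fun f => comp_lfun1l f)
  (fun f => comp_lfun1r f) (fun f g h => comp_lfunDl f g h)
  (fun f g h => comp_lfunDr f g h) weight_end1_neq0.
HB.instance Definition _ := GRing.Lmodule_isLalgebra.Build K weight_end
  (fun a f g => comp_lfunZl a f g).
HB.instance Definition _ := GRing.Lalgebra_isAlgebra.Build K weight_end
  (fun a f g => comp_lfunZr a f g).

Lemma weight_end_mulE (f g : weight_end) v : (f * g) v = f (g v).
Proof. exact: comp_lfunE. Qed.

End WeightSpace.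

(* The pair (a, b) of indices is encoded as mxvec_index a b : 'I_(n * n). *)
Notation matrix_poly K n := (mpoly.mpoly (n * n) K).

Section TwistedGroupAlgebra.

Variables (K : fieldType) (n : nat).
Implicit Types (g h s : 'S_n) (p : matrix_poly K n).

Definition Xvar (a b : 'I_n) : matrix_poly K n :=
  mpoly.mpolyX K (mpoly.mnm1 (mxvec_index a b)).

(* mxvec flattens along mxvec_index, so this replaces X_{a b} by
   X_{g(a) g(b)}; see perm_act_Xvar. *)
Definition perm_act g p : matrix_poly K n :=
  mpoly.comp_mpoly
    [tuple mxvec (\matrix_(a, b) Xvar (g a) (g b)) 0 k | k < n * n] p.

HB.instance Definition _ g := GRing.LRMorphism.copy (perm_act g)
  (mpoly.comp_mpoly
    [tuple mxvec (\matrix_(a, b) Xvar (g a) (g b)) 0 k | k < n * n]).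

Lemma perm_act_Xvar g a b : perm_act g (Xvar a b) = Xvar (g a) (g b).
Proof.
by rewrite /perm_act mpoly.comp_mpolyXU -tnth_nth tnth_mktuple mxvecE mxE.
Qed.

Lemma matrix_poly_lrmorph_eq (A : lalgType K)
    (f1 f2 : {lrmorphism matrix_poly K n -> A}) :
  (forall a b, f1 (Xvar a b) = f2 (Xvar a b)) -> f1 =1 f2.
Proof.
move=> f12 p; rewrite [p]mpoly.mpolyE !linear_sum; apply: eq_bigr => m _.
rewrite !linearZ /=; congr (_ *: _).
rewrite mpoly.mpolyXE_id !rmorph_prod; apply: eq_bigr => k _.
by case/mxvec_indexP: k => a b; rewrite !rmorphXn /= -/(Xvar a b) f12.
Qed.

Lemma perm_act1 p : perm_act 1 p = p.
Proof.
apply: (@matrix_poly_lrmorph_eq _ (perm_act 1) idfun) => a b /=.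
by rewrite perm_act_Xvar !perm1.
Qed.

Lemma perm_actM g h p : perm_act g (perm_act h p) = perm_act (h * g) p.
Proof.
apply: (@matrix_poly_lrmorph_eq _ (perm_act g \o perm_act h)) => a b /=.
by rewrite !perm_act_Xvar !permM.
Qed.

Definition twisted_group_algebra := {ffun 'S_n -> matrix_poly K n}.

HB.instance Definition _ := GRing.Lmodule.on twisted_group_algebra.

(* The element p g. *)
Definition twisted p g : twisted_group_algebra :=
  [ffun s => if s == g then p else 0].

(* The library's product of permutations applies the left factor first, so
   (h * g)%g is the composition in which h is applied first. *)
Definition twisted_mul (x y : twisted_group_algebra) : twisted_group_algebra :=
  \sum_g \sum_h twisted (x g * perm_act g (y h)) (h * g)%g.

Definition twisted_one : twisted_group_algebra := twisted 1 1%g.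

Implicit Types x y z : twisted_group_algebra.

Lemma twisted_mulE x y s :
  twisted_mul x y s = \sum_g x g * perm_act g (y (s * g^-1)%g).
Proof.
rewrite /twisted_mul sum_ffunE; apply: eq_bigr => g _.
rewrite sum_ffunE (bigD1 (s * g^-1)%g) //= ffunE mulgKV eqxx big1 ?addr0 //.
move=> h hs; rewrite ffunE; case: eqP => // sE.
by rewrite sE mulgK eqxx in hs.
Qed.

Lemma twisted_mulA : associative twisted_mul.
Proof.
move=> x y z; apply/ffunP => s; rewrite !twisted_mulE.
under [RHS]eq_bigr do rewrite twisted_mulE mulr_suml.
rewrite exchange_big; apply: eq_bigr => g _ /=.
rewrite twisted_mulE rmorph_sum mulr_sumr /=.
rewrite [RHS](reindex_inj (mulIg g)) /=; apply: eq_bigr => h _.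
by rewrite rmorphM /= perm_actM mulrA mulgK invMg mulgA.
Qed.

Lemma twisted_mul1l : left_id twisted_one twisted_mul.
Proof.
move=> x; apply/ffunP => s; rewrite twisted_mulE (bigD1 1%g) //= big1.
  by rewrite ffunE eqxx mul1r perm_act1 invg1 mulg1 addr0.
by move=> g /negbTE g1; rewrite ffunE g1 mul0r.
Qed.

Lemma twisted_mul1r : right_id twisted_one twisted_mul.
Proof.
move=> x; apply/ffunP => s; rewrite twisted_mulE (bigD1 s) //= big1.
  by rewrite ffunE mulgV eqxx rmorph1 mulr1 addr0.
move=> g gs; rewrite ffunE -(inj_eq (mulIg g)) mulgKV mul1g eq_sym (negbTE gs).
by rewrite raddf0 mulr0.
Qed.

Lemma twisted_mulDl : left_distributive twisted_mul +%R.
Proof.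
move=> x y z; apply/ffunP => s; rewrite ffunE !twisted_mulE -big_split /=.
by apply: eq_bigr => g _; rewrite ffunE mulrDl.
Qed.

Lemma twisted_mulDr : right_distributive twisted_mul +%R.
Proof.
move=> x y z; apply/ffunP => s; rewrite ffunE !twisted_mulE -big_split /=.
by apply: eq_bigr => g _; rewrite ffunE raddfD mulrDr.
Qed.

Lemma twisted_one_neq0 : twisted_one != 0.
Proof.
by apply/eqP => /ffunP /(_ 1%g); rewrite !ffunE eqxx; apply/eqP/oner_neq0.
Qed.

HB.instance Definition _ := GRing.Zmodule_isNzRing.Build twisted_group_algebra
  twisted_mulA twisted_mul1l twisted_mul1r twisted_mulDl twisted_mulDr
  twisted_one_neq0.

Lemma twisted_scaleAl (c : K) x y : c *: (x * y) = (c *: x) * y.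
Proof.
apply/ffunP => s; rewrite ffunE [in LHS]twisted_mulE [RHS]twisted_mulE.
by rewrite scaler_sumr; apply: eq_bigr => g _; rewrite ffunE scalerAl.
Qed.

HB.instance Definition _ :=
  GRing.Lmodule_isLalgebra.Build K twisted_group_algebra twisted_scaleAl.

Lemma twisted_scaleAr (c : K) x y : c *: (x * y) = x * (c *: y).
Proof.
apply/ffunP => s; rewrite ffunE [in LHS]twisted_mulE [RHS]twisted_mulE.
rewrite scaler_sumr; apply: eq_bigr => g _.
by rewrite ffunE linearZ /= scalerAr.
Qed.

HB.instance Definition _ :=
  GRing.Lalgebra_isAlgebra.Build K twisted_group_algebra twisted_scaleAr.

Lemma twistedM p g r h :
  twisted p g * twisted r h = twisted (p * perm_act g r) (h * g)%g.
Proof.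
apply/ffunP => s; rewrite [LHS]twisted_mulE (bigD1 g) //= big1; last first.
  by move=> k /negbTE kg; rewrite ffunE kg mul0r.
rewrite addr0 !ffunE eqxx -(inj_eq (mulIg g)) mulgKV.
by case: ifP; rewrite ?raddf0 ?mulr0.
Qed.

End TwistedGroupAlgebra.

Section Operators.

Variables (K : fieldType) (I : finType) (q : I -> I -> K) (Q : {mset I}).
Implicit Types (j : arrangement Q) (g : 'S_(size Q)) (a b : 'I_(size Q)).

Definition diag_op a b : weight_end K Q :=
  linfun (linear_extension
    (fun j => q (tnth (val j) a) (tnth (val j) b) *: basis_monomial K j)).

Lemma diag_op_basis a b j :
  diag_op a b (basis_monomial K j)
    = q (tnth (val j) a) (tnth (val j) b) *: basis_monomial K j.
Proof. by rewrite lfunE /= linear_extension_basis. Qed.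

Lemma permuted_subproof g j :
  perm_eq [tuple tnth (val j) (g^-1%g i) | i < size Q] Q.
Proof.
apply: perm_trans (valP j); apply/tuple_permP.
by exists g^-1%g.
Qed.

Definition permuted g j : arrangement Q :=
  exist (fun w : (size Q).-tuple I => perm_eq w Q) _ (permuted_subproof g j).

(* Evaluation at X_{a b} := diag_op a b; mmap applies to noncommutative
   targets, and rho1 is an algebra morphism because the diag_op commute. *)
Definition rho1 (p : matrix_poly K (size Q)) : weight_end K Q :=
  mpoly.mmap (in_alg (weight_end K Q)) (mxvec (\matrix_(a, b) diag_op a b) 0) p.

Definition rho2 g : weight_end K Q :=
  linfun (linear_extension (fun j => basis_monomial K (permuted g j))).

Lemma rho2_basis g j :
  rho2 g (basis_monomial K j) = basis_monomial K (permuted g j).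
Proof. by rewrite lfunE /= linear_extension_basis. Qed.

Lemma rho1_Xvar a b : rho1 (Xvar K a b) = diag_op a b.
Proof.
by rewrite /rho1 mpoly.mmapX mpoly.mmap1U mxvecE mxE.
Qed.

Lemma weight_end_eq (f1 f2 : weight_end K Q) :
  (forall j, f1 (basis_monomial K j) = f2 (basis_monomial K j)) -> f1 = f2.
Proof.
move=> f12; apply/lfunP => v; rewrite (weight_space_sum v) !linear_sum.
by apply: eq_bigr => j _; rewrite !linearZ /= f12.
Qed.

Lemma rho1_basis p j :
  rho1 p (basis_monomial K j) =
    mpoly.meval
      (mxvec (\matrix_(a, b) q (tnth (val j) a) (tnth (val j) b)) 0) p
    *: basis_monomial K j.
Proof.
rewrite /rho1 /mpoly.meval /mpoly.mmap sum_lfunE scaler_suml.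
apply: eq_bigr => m _; rewrite weight_end_mulE.
have -> : mpoly.mmap1 (mxvec (\matrix_(a, b) diag_op a b) 0) m
            (basis_monomial K j)
  = mpoly.mmap1 (mxvec (\matrix_(a, b) q (tnth (val j) a) (tnth (val j) b)) 0) m
    *: basis_monomial K j.
  rewrite /mpoly.mmap1.
  elim/big_rec2: _ => [|k c f _ IH]; first by rewrite id_lfunE scale1r.
  rewrite weight_end_mulE IH linearZ /= -scalerA [RHS]scalerA mulrC -scalerA.
  congr (_ *: _).
  case/mxvec_indexP: k => a b; rewrite !mxvecE !mxE.
  elim: (m _) => [|d IHd]; first by rewrite !expr0 id_lfunE scale1r.
  by rewrite exprSr weight_end_mulE diag_op_basis linearZ /= IHd scalerA -exprS.
by rewrite /= scale_lfunE id_lfunE scalerA.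
Qed.

Fact rho1_is_linear : linear rho1.
Proof.
move=> c p r; apply: weight_end_eq => j.
by rewrite add_lfunE scale_lfunE !rho1_basis linearP /= scalerDl scalerA.
Qed.

Fact rho1_is_monoid_morphism : monoid_morphism rho1.
Proof.
split=> [|p r]; apply: weight_end_eq => j.
  by rewrite rho1_basis rmorph1 scale1r id_lfunE.
rewrite weight_end_mulE !rho1_basis linearZ /= rho1_basis scalerA.
by rewrite rmorphM mulrC.
Qed.

HB.instance Definition _ :=
  GRing.isLinear.Build K (matrix_poly K (size Q)) (weight_end K Q) _ rho1
    rho1_is_linear.
HB.instance Definition _ :=
  GRing.isMonoidMorphism.Build (matrix_poly K (size Q)) (weight_end K Q) rho1
    rho1_is_monoid_morphism.

End Operators.

(* Main.v *)
Require Import Defs.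
From HB Require Import structures.
From mathcomp Require Import all_boot all_order all_algebra all_fingroup.
From mathcomp Require Import finmap multiset mpoly monalg complex reals.

Set Implicit Arguments.
Unset Strict Implicit.
Unset Printing Implicit Defensive.

Import GRing.Theory.
Local Open Scope mset_scope.
Local Open Scope ring_scope.

(** An algebra morphism out of the twisted group algebra R_n x| K[S_n] is the
    same thing as a covariant pair: an algebra morphism phi on R_n together
    with a multiplicative map u on S_n such that
      u g * phi p = phi (g . p) * u g.
    Indeed covariance is just what is needed to carry u g past phi r in
      (phi p * u g) * (phi r * u h) = phi (p * (g . r)) * (u g * u h),
    and the latter mirrors the product of the monomials p g and r h; since
    these monomials span the algebra additively, they determine the morphism
    (twisted_sum, twisted_morphism).

    It remains to see that rho1 and rho2 form such a pair.  Multiplicativity of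
    rho2 is functoriality of the action of permutations on words (permutedM).
    Covariance holds because every basis monomial e_j is a common eigenvector
    of all rho1 p, with eigenvalue the value of p at X_{a b} := q_{j_a j_b}:
    the word g . j has at position g(a) the letter that j has at position a, so
    evaluating g . p at the point of g . j is evaluating p at the point of j
    (meval_perm_act). *)

(** The monomials p g span the algebra additively, which gives the uniqueness
    of an additive map prescribed on them. *)
Lemma twisted_sum (K : fieldType) (n : nat) (x : twisted_group_algebra K n) :
  x = \sum_g twisted (x g) g.
Proof.
apply/ffunP => s; rewrite sum_ffunE (bigD1 s) //= ffunE eqxx big1 ?addr0 //.
by move=> g gs; rewrite ffunE eq_sym (negbTE gs).
Qed.

(** Universal property of the crossed product, in its existence part.  The
    order of the factors in uM is due to (h * g)%g being the composition that
    applies h first. *)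
Lemma twisted_morphism (K : fieldType) (n : nat) (A : algType K)
    (phi : {lrmorphism matrix_poly K n -> A}) (u : 'S_n -> A)
    (u1 : u 1%g = 1) (uM : forall g h, u g * u h = u (h * g)%g)
    (phi_u : forall g p, u g * phi p = phi (perm_act g p) * u g) :
  exists rho : {lrmorphism twisted_group_algebra K n -> A},
    forall p g, rho (twisted p g) = phi p * u g.
Proof.
pose rho (x : twisted_group_algebra K n) := \sum_g phi (x g) * u g.
have rho_twisted p g : rho (twisted p g) = phi p * u g.
  rewrite /rho (bigD1 g) //= ffunE eqxx big1 ?addr0 // => h /negbTE hg.
  by rewrite ffunE hg raddf0 mul0r.
have rho_linear : linear rho.
  move=> c x y; rewrite /rho scaler_sumr -big_split /=.
  by apply: eq_bigr => g _; rewrite !ffunE linearP mulrDl scalerAl.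
pose rhoL : {linear twisted_group_algebra K n -> A} :=
  HB.pack rho (GRing.isLinear.Build K _ _ _ rho rho_linear).
have rho_sum (F : 'S_n -> twisted_group_algebra K n) :
    rho (\sum_g F g) = \sum_g rho (F g).
  exact: (linear_sum rhoL).
have rho_monoid : monoid_morphism rho.
  split=> [|x y]; first by rewrite rho_twisted rmorph1 u1 mulr1.
  rewrite [x * y]/(twisted_mul x y) rho_sum [in RHS]/rho mulr_suml.
  apply: eq_bigr => g _; rewrite rho_sum mulr_sumr; apply: eq_bigr => h _.
  by rewrite rho_twisted rmorphM /= -uM !mulrA -(mulrA _ (u g) (phi _)) phi_u !mulrA.
pose rhoLR : {lrmorphism twisted_group_algebra K n -> A} :=
  HB.pack rho (GRing.isLinear.Build K _ _ _ rho rho_linear)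
    (GRing.isMonoidMorphism.Build _ _ rho rho_monoid).
by exists rhoLR.
Qed.

Lemma permuted1 (I : finType) (Q : {mset I}) (j : arrangement Q) :
  permuted 1 j = j.
Proof.
by apply/val_inj/eq_from_tnth => i; rewrite tnth_mktuple invg1 perm1.
Qed.

Lemma permutedM (I : finType) (Q : {mset I}) (g h : 'S_(size Q))
    (j : arrangement Q) :
  permuted g (permuted h j) = permuted (h * g) j.
Proof.
by apply/val_inj/eq_from_tnth => i; rewrite !tnth_mktuple invMg permM.
Qed.

Lemma tnth_permuted (I : finType) (Q : {mset I}) (g : 'S_(size Q))
    (j : arrangement Q) (a : 'I_(size Q)) :
  tnth (val (permuted g j)) (g a) = tnth (val j) a.
Proof. by rewrite tnth_mktuple permK. Qed.

Lemma rho2_1 (K : fieldType) (I : finType) (Q : {mset I}) :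
  rho2 K (1%g : 'S_(size Q)) = 1.
Proof.
by apply: weight_end_eq => j; rewrite rho2_basis permuted1 id_lfunE.
Qed.

Lemma rho2M (K : fieldType) (I : finType) (Q : {mset I})
    (g h : 'S_(size Q)) :
  rho2 K g * rho2 K h = rho2 K (h * g)%g.
Proof.
by apply: weight_end_eq => j; rewrite weight_end_mulE !rho2_basis permutedM.
Qed.

(** Both sides are algebra morphisms in p, so this reduces to the variables,
    where it is tnth_permuted. *)
Lemma meval_perm_act (K : fieldType) (I : finType) (q : I -> I -> K)
    (Q : {mset I}) (g : 'S_(size Q)) (j : arrangement Q)
    (p : matrix_poly K (size Q)) :
  let point (i : arrangement Q) :=
    mxvec (\matrix_(a, b) q (tnth (val i) a) (tnth (val i) b)) 0 in
  mpoly.meval (point (permuted g j)) (perm_act g p)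
    = mpoly.meval (point j) p.
Proof.
rewrite /= /perm_act mpoly.comp_mpoly_meval; apply: mpoly.meval_eq => k.
case/mxvec_indexP: k => a b.
rewrite tnth_mktuple !mxvecE !mxE /Xvar mpoly.mevalXU mxvecE mxE.
by rewrite !tnth_permuted.
Qed.

(** Compared on a basis monomial e_j, both sides are multiples of e_{g . j}, and
    the scalars are the two values equated by meval_perm_act. *)
Lemma rho2_rho1 (K : fieldType) (I : finType) (q : I -> I -> K)
    (Q : {mset I}) (g : 'S_(size Q)) (p : matrix_poly K (size Q)) :
  rho2 K g * rho1 q p = rho1 q (perm_act g p) * rho2 K g.
Proof.
apply: weight_end_eq => j; rewrite !weight_end_mulE rho2_basis !rho1_basis.
by rewrite linearZ /= rho2_basis meval_perm_act.
Qed.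

Theorem proposition4p5 (R : realType) (N : {fset nat}) (q : N -> N -> R[i]) (Q : {mset N}) :
  exists rho : {lrmorphism twisted_group_algebra R[i] (size Q)
                  -> weight_end R[i] Q},
    (forall (p : matrix_poly R[i] (size Q)) (g : 'S_(size Q)),
       rho (twisted p g) = rho1 q p * rho2 R[i] g)
    /\ (forall rho' : {additive twisted_group_algebra R[i] (size Q)
                         -> weight_end R[i] Q},
         (forall (p : matrix_poly R[i] (size Q)) (g : 'S_(size Q)),
            rho' (twisted p g) = rho1 q p * rho2 R[i] g) ->
         rho' =1 rho).
Proof.
have [rho rhoE] := twisted_morphism (rho2_1 R[i] Q) (@rho2M R[i] N Q)
  (@rho2_rho1 R[i] N q Q).
exists rho; split=> // rho' rho'E x.
rewrite (twisted_sum x) !raddf_sum; apply: eq_bigr => g _.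
rewrite rho'E; exact/esym/rhoE.
Qed.
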